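(* Let $q$ be a prime power, let $s\ge 1$ be an integer and let $e_1,\ldots,e_s$ be distinct non-negative integers. Let $S_{e_1,\ldots,e_s}(q)$ denote the number of equivalence classes, under dynamical equivalence, of the dynamical systems $(\mathbb{F}_q, x\mapsto f(x))$ where $f$ ranges over all polynomials of the form $f(X)=\sum_{i=1}^s a_iX^{e_i}\in\mathbb{F}_q[X]$ with $a_1,\ldots,a_s\in\mathbb{F}_q^*=\mathbb{F}_q\setminus\{0\}$. Then $$S_{e_1,\ldots,e_s}(q)\le (q-1)^{s-1}\gcd(e_1-1,\ldots,e_s-1,q-1).$$
   Context: A dynamical system is a pair $(\mathbb{S},f)$ with $f:\mathbb{S}\to\mathbb{S}$ a map. Two dynamical systems $(\mathbb{S},f)$ and $(\mathbb{T},g)$ are dynamically equivalent if there is a bijection $\sigma:\mathbb{S}\to\mathbb{T}$ with $\sigma^{-1}\circ g\circ\sigma=f$ (equivalently, their functional graphs, i.e. the directed graphs with an edge $x\to f(x)$, are isomorphic). $\mathbb{F}_q$ is the finite field with $q$ elements. *)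

(* Defs.v *)
From HB Require Import structures.
From mathcomp Require Import all_boot all_order all_algebra.

Set Implicit Arguments.
Unset Strict Implicit.
Unset Printing Implicit Defensive.

Import GRing.Theory.
Local Open Scope ring_scope.

Definition dyn_equiv (S T : Type) (f : S -> S) (g : T -> T) : Prop :=
  exists (sigma : S -> T) (tau : T -> S),
    [/\ cancel sigma tau, cancel tau sigma & tau \o g \o sigma =1 f].

Definition dyn_equivb (S T : finType) (f : S -> S) (g : T -> T) : bool :=
  [exists sigma : {ffun S -> T}, exists tau : {ffun T -> S},
    [&& [forall x, tau (sigma x) == x], [forall y, sigma (tau y) == y]
      & [forall x, tau (g (sigma x)) == f x]]].

Lemma dyn_equivP (S T : finType) (f : S -> S) (g : T -> T) :
  reflect (dyn_equiv f g) (dyn_equivb f g).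
Proof.
apply: (iffP existsP) => [[sigma /existsP[tau]]|[sigma [tau [st ts fg]]]].
  case/and3P=> /forallP st /forallP ts /forallP fg.
  exists sigma, tau; split=> x; apply/eqP; [exact: st|exact: ts|exact: fg].
exists (finfun sigma); apply/existsP; exists (finfun tau).
apply/and3P; split; apply/forallP => x; rewrite !ffunE ?st ?ts //.
by apply/eqP; apply: fg.
Qed.

Lemma dyn_equiv_refl (S : Type) (f : S -> S) : dyn_equiv f f.
Proof. by exists id, id. Qed.

Lemma dyn_equiv_sym (S T : Type) (f : S -> S) (g : T -> T) :
  dyn_equiv f g -> dyn_equiv g f.
Proof.
by case=> sigma [tau [st ts fg]]; exists tau, sigma; split=> // y /=;
   rewrite -fg /= !ts.
Qed.

Lemma dyn_equiv_trans (S T U : Type) (f : S -> S) (g : T -> T) (h : U -> U) :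
  dyn_equiv f g -> dyn_equiv g h -> dyn_equiv f h.
Proof.
case=> sigma [tau [st ts fg]] [sigma' [tau' [st' ts' gh]]].
exists (sigma' \o sigma), (tau \o tau'); split=> x /=.
- by rewrite st' st.
- by rewrite ts ts'.
- by rewrite -fg /= -gh.
Qed.

Definition dyn_rel (S : finType) : rel {ffun S -> S} :=
  fun f g => dyn_equivb f g.

Lemma dyn_rel_equivalence (S : finType) : equivalence_rel (@dyn_rel S).
Proof.
move=> f g h; split; first by apply/dyn_equivP/dyn_equiv_refl.
move=> /dyn_equivP fg; apply/dyn_equivP/dyn_equivP => fh.
  exact: dyn_equiv_trans (dyn_equiv_sym fg) fh.
exact: dyn_equiv_trans fg fh.
Qed.

Section ExponentSystems.
Variables (F : finFieldType) (s : nat) (e : 'I_s -> nat).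

Definition exp_poly (a : 'I_s -> F) : {poly F} :=
  \sum_(i < s) a i *: 'X^(e i).

Definition exp_systems : {set {ffun F -> F}} :=
  [set [ffun x : F => (exp_poly a).[x]]
     | a : {ffun 'I_s -> F} & [forall i, a i != 0]].

Definition num_dyn_classes : nat :=
  #|equivalence_partition (@dyn_rel F) exp_systems|.

End ExponentSystems.

(* gcd(e_1 - 1, ..., e_s - 1), with the subtractions taken in the integers:
   [e i = 0] contributes [-1], not a truncated [0]. *)
Definition exp_gcd (s : nat) (e : 'I_s -> nat) : nat :=
  \big[gcdn/0%N]_(i < s) absz ((e i)%:Z - 1).

(* Main.v *)
(* Conjugating f by x |-> c x, with c a unit, multiplies the coefficient a_i by
   c^(e_i - 1).  This is an action of the q - 1 units on the (q - 1)^s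
   coefficient vectors, in which every stabilizer consists of g-th roots of
   unity for g = gcd(e_1 - 1, ..., e_s - 1, q - 1), hence has at most g
   elements.  Fixing a coefficient vector a_B in each class B, the map
   (B, c) |-> c . a_B therefore has fibers of size at most g, because B is
   determined by c . a_B; so (number of classes) * (q - 1) <= (q - 1)^s * g. *)
Require Import Defs.
From mathcomp Require Import all_boot all_order all_algebra.
From mathcomp Require Import all_fingroup all_solvable all_field.

Import GRing.Theory.

Lemma leq_card_fibers {aT rT : finType} (f : aT -> rT) (A : {pred aT}) (n : nat) :
  (forall y, #|[pred x in A | f x == y]| <= n) -> #|A| <= #|rT| * n.
Proof.
move=> fib; rewrite -sum1_card (partition_big f predT) //= -sum_nat_const.
by apply: leq_sum => y _; rewrite sum1dep_card cardsE; apply: fib.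
Qed.

(** Such units are distinct roots in [F] of X^n - 1, a nonzero polynomial of degree n. *)
Lemma card_unit_expg_le (F : finFieldType) (n : nat) :
  0 < n -> #|[set u : {unit F} | (u ^+ n)%g == 1%g]| <= n.
Proof.
move=> n_gt0; set A := [set u | _].
rewrite cardE -(size_map (val : {unit F} -> F)); apply: max_unity_roots => //.
  apply/allP=> _ /mapP[u uA ->]; move: uA; rewrite mem_enum inE => /eqP un1.
  by apply/unity_rootP; rewrite -FinRing.val_unitX un1 FinRing.val_unit1.
by rewrite map_inj_uniq ?enum_uniq //; apply: val_inj.
Qed.

(** Cancelling one [x] turns x^(n+1) = x into x^n = 1. An exponent 0 forces x = 1, in accord with
    the term |0 - 1| = 1 of the gcd. *)
Lemma order_dvd_exp_gcd {gT : finGroupType} {s : nat} (e : 'I_s -> nat) (x : gT) :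
  (forall i, (x ^+ e i)%g = x) -> #[x]%g %| exp_gcd e.
Proof.
move=> xe; apply/dvdn_biggcdP => i _; move: (xe i).
case: (e i) => [|n]; first by rewrite expg0 => <-; rewrite order1 dvd1n.
move/eqP; rewrite expgS -[X in _ == X]mulg1 (inj_eq (mulgI x)) -order_dvdn.
by rewrite -addn1 PoszD addrK absz_nat.
Qed.

Lemma equivalence_partition_block_eq {T : finType} {R : rel T} {D : {set T}}
    {B C : {set T}} {x y : T} :
  equivalence_rel R ->
  B \in equivalence_partition R D -> C \in equivalence_partition R D ->
  x \in B -> y \in C -> R x y -> B = C.
Proof.
move=> eqR BP CP xB yC Rxy.
have eqRD : {in D & &, equivalence_rel R} by move=> a b c _ _ _; apply: eqR.
have part := equivalence_partitionP eqRD.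
have inD A z : A \in equivalence_partition R D -> z \in A -> z \in D.
  by move=> AP zA; rewrite -(cover_partition part); apply/bigcupP; exists A.
have tI : trivIset (equivalence_partition R D) by case/and3P: part.
rewrite -(def_pblock tI BP xB) -(def_pblock tI CP yC).
apply/eqP; rewrite eq_pblock //; last by rewrite (cover_partition part) (inD B).
by rewrite pblock_equivalence_partition // (inD _ _ BP xB, inD _ _ CP yC).
Qed.

Section UnitCoefficients.
Context {F : finFieldType} {s : nat} (e : 'I_s -> nat).
Implicit Types (a : {ffun 'I_s -> {unit F}}) (c : {unit F}).

Definition unit_system a : {ffun F -> F} :=
  [ffun x => (exp_poly e (fun i => val (a i))).[x]%R].

(** The product [c ^+ e i * c^-1] stands for c^(e_i - 1) and remains correct when [e i] is 0, where
    truncated subtraction would give 1. *)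
Definition rescale a c : {ffun 'I_s -> {unit F}} :=
  [ffun i => (a i * (c ^+ e i * c^-1))%g].

Lemma unit_systemE a x :
  unit_system a x = (\sum_(i < s) val (a i) * x ^+ e i)%R.
Proof.
rewrite ffunE horner_sum; apply: eq_bigr => i _.
by rewrite hornerZ hornerXn.
Qed.

Lemma exp_systems_unit f : f \in exp_systems F e -> exists a, f = unit_system a.
Proof.
case/imsetP=> a; rewrite inE => /forallP a_neq0 ->.
have a_unit i : (a i \is a GRing.unit)%R by rewrite unitfE.
exists [ffun i => FinRing.unit F (a_unit i)]; apply/ffunP=> x.
rewrite !ffunE; congr (_.[x])%R; apply: eq_bigr => i _.
by rewrite ffunE.
Qed.

Lemma dyn_rel_rescale a c : dyn_rel (unit_system (rescale a c)) (unit_system a).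
Proof.
apply/dyn_equivP; have c_unit := valP c.
exists (fun x => val c * x)%R, (fun x => (val c)^-1 * x)%R; split=> x /=.
- by rewrite mulKr.
- by rewrite mulVKr.
rewrite !unit_systemE mulr_sumr; apply: eq_bigr => i _.
rewrite ffunE !FinRing.val_unitM FinRing.val_unitX FinRing.val_unitV exprMn.
by rewrite mulrC -!mulrA; congr (_ * (_ * _))%R; rewrite mulrC.
Qed.

(** Cancelling [a i] and using commutativity of the unit group, (c/d)^(e_i) = c/d for every i. *)
Lemma rescale_order a c d :
  rescale a c = rescale a d -> #[c * d^-1]%g %| exp_gcd e.
Proof.
have com (x y : {unit F}) : commute x y.
  by apply: val_inj; rewrite !FinRing.val_unitM mulrC.
move=> eq_ac; apply: order_dvd_exp_gcd => i.
have := congr1 (fun f : {ffun 'I_s -> {unit F}} => f i) eq_ac.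
rewrite !ffunE => /mulgI eq_cd.
rewrite expgMn // expgVn -[(c ^+ e i)%g](mulgKV c) eq_cd.
by rewrite [LHS]com !mulgA mulVg mul1g com.
Qed.

(** The all-ones vector is a mere default: a class of the partition contains some [unit_system a],
    so [pick] succeeds on it. *)
Definition class_coef (B : {set {ffun F -> F}}) : {ffun 'I_s -> {unit F}} :=
  odflt [ffun=> 1%g] [pick a | unit_system a \in B].

Lemma class_coefP B :
  B \in equivalence_partition (@dyn_rel F) (exp_systems F e) ->
  unit_system (class_coef B) \in B.
Proof.
rewrite /class_coef; case: pickP => // noB /imsetP[f fS defB].
have [a def_f] := exp_systems_unit f fS.
move: (noB a); rewrite -def_f defB inE fS.
by rewrite (dyn_rel_equivalence f f f).1.
Qed.

End UnitCoefficients.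

Theorem theorem3p1 (q : nat) (F : finFieldType) (hq : #|F| = q)
    (s : nat) (hs : 1 <= s) (e : 'I_s -> nat) (he : injective e) :
  num_dyn_classes F e <= (q - 1) ^ (s - 1) * gcdn (exp_gcd e) (q - 1).
Proof.
have cardU : #|{: {unit F}}| = q - 1.
  by rewrite -cardsT card_finField_unit hq subn1.
have q1_gt0 : 0 < q - 1 by rewrite -cardU; apply/card_gt0P; exists 1%g.
set g := gcdn _ _; have g_gt0 : 0 < g by rewrite gcdn_gt0 q1_gt0 orbT.
rewrite /num_dyn_classes; set P := equivalence_partition _ _.
pose act (p : {set {ffun F -> F}} * {unit F}) :=
  rescale e (class_coef e p.1) p.2.
(* Each class contains a system equivalent to that of its rescaled vector, so equal vectors force
   equal classes. The ratio of the scalars then has order dividing [exp_gcd e], and dividing q - 1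
   by Lagrange. *)
have act_inj p p' : p.1 \in P -> p'.1 \in P -> act p = act p' ->
    p.1 = p'.1 /\ ((p.2 * p'.2^-1) ^+ g = 1)%g.
  case: p p' => [B c] [C d] /= BP CP eq_act.
  have eqBC : B = C.
    apply: (equivalence_partition_block_eq (@dyn_rel_equivalence F) BP CP
              (class_coefP e B BP) (class_coefP e C CP)).
    apply/dyn_equivP.
    have /dyn_equivP/dyn_equiv_sym BB := dyn_rel_rescale e (class_coef e B) c.
    have /dyn_equivP CC := dyn_rel_rescale e (class_coef e C) d.
    by apply: dyn_equiv_trans BB _; rewrite -[rescale _ _ _]/(act (B, c)) eq_act.
  split=> //; apply/eqP; rewrite -order_dvdn dvdn_gcd.
  rewrite -cardU -cardsT order_dvdG ?inE // andbT.
  by move: eq_act; rewrite eqBC; apply: rescale_order.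
suff: #|setX P [set: {unit F}]| <= #|{: {ffun 'I_s -> {unit F}}}| * g.
  rewrite cardsX cardsT card_ffun cardU card_ord.
  (* As s >= 1, one factor q - 1 splits off and cancels against the number of units. *)
  have ->: (q - 1) ^ s = (q - 1) * (q - 1) ^ (s - 1).
    by rewrite -expnS (subn1 s) prednK.
  by rewrite mulnC -mulnA leq_pmul2l.
apply: (leq_card_fibers act) => y.
case: (pickP [pred p in setX P [set: {unit F}] | act p == y]) => [[B0 c0]|]; last first.
  by move=> no_pre; rewrite eq_card0 // => p; apply: no_pre.
case/andP=> /setXP[B0P _] /eqP act0.
apply: leq_trans (card_unit_expg_le F g g_gt0).
(* Dividing by the scalar [c0] of a fixed point of the fiber sends the fiber into the g-th roots of
   unity. This is injective because [y] already determines the class. *)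
rewrite -(@card_in_imset _ _ (fun p => p.2 * c0^-1)%g).
  apply/subset_leq_card/subsetP=> _ /imsetP[[B c] /andP[/setXP[BP _] /eqP act_B] ->].
  by rewrite inE; apply/eqP; apply: (act_inj (B, c) (B0, c0) BP B0P _).2; rewrite act_B.
move=> [B c] [C d] /andP[/setXP[BP _] /eqP act_B] /andP[/setXP[CP _] /eqP act_C].
move=> /= /mulIg ->; congr (_, _).
by apply: (act_inj (B, c) (C, d) BP CP _).1; rewrite act_B.
Qed.
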